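(* Let $\mathcal{A}$ be a finite alphabet and let $w \in \mathcal{A}^*$ be a finite word that is not rich. Then $w$ has two factors $u$ and $v$ such that $$u \neq \widetilde{v}, \qquad u, v \text{ are rich}, \qquad \operatorname{lps}(u) = \operatorname{lpp}(v), \qquad \operatorname{lps}(v) = \operatorname{lpp}(u).$$
   Context: Let $\mathcal{A}$ be a finite set (alphabet) and $\mathcal{A}^*$ the set of all finite words over $\mathcal{A}$, including the empty word; $|w|$ denotes the length of $w$. A word $f$ is a factor of $w$ if $w = pfs$ for some (possibly empty) words $p, s$; such $p$ is called a prefix and $s$ a suffix of $w$ (so prefixes and suffixes may be empty or equal to the whole word). The reversal of $w = w_0 w_1 \cdots w_{n-1}$ is $\widetilde{w} = w_{n-1} \cdots w_1 w_0$, and $w$ is a palindrome if $w = \widetilde{w}$ (the empty word is a palindrome). A finite word $w$ of length $n$ has at most $n+1$ distinct palindromic factors (counting the empty word); its palindromic defect $D(w)$ is $n+1$ minus the number of distinct palindromic factors of $w$ (the empty word included), and $w$ is called rich if $D(w) = 0$. For a finite word $w$, $\operatorname{lps}(w)$ denotes the longest palindromic suffix of $w$ and $\operatorname{lpp}(w)$ denotes the longest palindromic prefix of $w$. *)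

(* Defs.v *)
From mathcomp Require Import all_boot.

Set Implicit Arguments.
Unset Strict Implicit.
Unset Printing Implicit Defensive.

(* "f is a factor of w" is [infix f w]; see [infixP]. *)

Definition palindrome (A : eqType) (w : seq A) : bool := w == rev w.

(* All factors of w, with repetitions; see [mem_factors]. *)
Definition factors (A : eqType) (w : seq A) : seq (seq A) :=
  [seq take j (drop i w) | i <- iota 0 (size w).+1, j <- iota 0 (size w).+1].

Definition pal_factors (A : eqType) (w : seq A) : seq (seq A) :=
  undup [seq f <- factors w | palindrome f].

(* The subtraction is on nat; it never truncates, because a word of length n
   has at most n.+1 distinct palindromic factors. *)
Definition defect (A : eqType) (w : seq A) : nat :=
  (size w).+1 - size (pal_factors w).

Definition rich (A : eqType) (w : seq A) : bool := defect w == 0.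

(* The suffixes are listed by decreasing length, so the first palindrome is the
   longest one; the default is never used as [::] is a palindromic suffix. *)
Definition lps (A : eqType) (w : seq A) : seq A :=
  head [::] [seq s <- [seq drop i w | i <- iota 0 (size w).+1] | palindrome s].

(* The prefixes are listed by increasing length: take the last palindrome. *)
Definition lpp (A : eqType) (w : seq A) : seq A :=
  last [::] [seq p <- [seq take i w | i <- iota 0 (size w).+1] | palindrome p].

Lemma mem_factors (A : eqType) (f w : seq A) : (f \in factors w) = infix f w.
Proof.
apply/allpairsP/infixP => [[[i j] /= [_ _ ->]]|[p [s ->]]].
  exists (take i w), (drop j (drop i w)).
  by rewrite !cat_take_drop.
exists (size p, size f); rewrite !mem_iota /= !add0n !ltnS !size_cat leq_addr.
rewrite addnCA leq_addr; split=> //.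
by rewrite drop_size_cat // take_size_cat.
Qed.

Lemma mem_pal_factors (A : eqType) (f w : seq A) :
  (f \in pal_factors w) = palindrome f && infix f w.
Proof. by rewrite mem_undup mem_filter mem_factors. Qed.

Lemma head_filter (T : Type) (x0 : T) (P : pred T) (s : seq T) :
  head x0 (filter P s) = nth x0 s (find P s).
Proof. by elim: s => //= x s IH; case: (P x). Qed.

Lemma lps_spec (A : eqType) (w : seq A) :
  [/\ suffix (lps w) w, palindrome (lps w)
    & forall s, suffix s w -> palindrome s -> size s <= size (lps w)].
Proof.
rewrite /lps head_filter; set l := map _ _; set k := find _ _.
have szl : size l = (size w).+1 by rewrite size_map size_iota.
have nthl i : i < (size w).+1 -> nth [::] l i = drop i w.
  by move=> lti; rewrite (nth_map 0) ?size_iota // nth_iota.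
have hasl : has (@palindrome A) l.
  by apply/hasP; exists [::] => //; apply/mapP; exists (size w);
    rewrite ?mem_iota ?add0n /= ?ltnSn ?drop_size.
have ltk : k < (size w).+1 by rewrite -szl -has_find.
split; [by rewrite nthl // suffix_drop | exact: nth_find |].
move=> s /suffixP[p Ew] pal_s; rewrite nthl // leqNgt; apply/negP.
rewrite size_drop => lt_s.
have ltp : size p < k.
  by rewrite ltnNge; apply/negP => lekp; move: lt_s;
    rewrite Ew size_cat -addnBAC // ltnNge leq_addl.
have := before_find [::] ltp.
by rewrite nthl ?(ltn_trans ltp) // Ew drop_size_cat // pal_s.
Qed.

Lemma lpp_spec (A : eqType) (w : seq A) :
  [/\ prefix (lpp w) w, palindrome (lpp w)
    & forall p, prefix p w -> palindrome p -> size p <= size (lpp w)].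
Proof.
have -> : lpp w = rev (lps (rev w)).
  have last_rev (T : Type) (x0 : T) l : last x0 l = head x0 (rev l).
    by case/lastP: l => // l x; rewrite last_rcons rev_rcons.
  have head_map l : head [::] (map (@rev A) l) = rev (head [::] l).
    by case: l.
  rewrite /lpp /lps last_rev -filter_rev -map_rev -head_map; congr head.
  rewrite !filter_map -map_comp size_rev.
  have -> : rev (iota 0 (size w).+1)
      = [seq size w - i | i <- iota 0 (size w).+1].
    apply: (@eq_from_nth _ 0) => [|i]; rewrite size_rev size_iota.
      by rewrite size_map size_iota.
    move=> lti; rewrite nth_rev ?size_iota // (nth_map 0) ?size_iota //.
    by rewrite !nth_iota ?subSS // ltnS leq_subr.
  rewrite filter_map -map_comp; move: (iota _ _) => s.
  have rdE i : rev (drop i (rev w)) = take (size w - i) w.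
    by rewrite drop_rev revK.
  rewrite (@eq_filter _ _ (preim (drop^~ (rev w)) (@palindrome A))).
    by apply: eq_map => i /=; rewrite rdE.
  by move=> i /=; rewrite -rdE /palindrome revK eq_sym.
have [suf pal max] := lps_spec (rev w).
have revpal s : palindrome s -> palindrome (rev s).
  by rewrite /palindrome revK eq_sym.
split; [by rewrite -suffix_rev revK | exact: revpal |].
move=> p pre_p pal_p; rewrite size_rev -[size p]size_rev.
by apply: max; [rewrite suffix_rev | exact: revpal].
Qed.

(* Main.v *)
Require Import Defs.
From mathcomp Require Import all_boot.
From mathcomp Require Import zify.

Set Implicit Arguments.
Unset Strict Implicit.
Unset Printing Implicit Defensive.

(** Pass to a factor of [w] that is not rich although all its proper factors
    are, and write it as [a :: rcons s b].

    A word gains at most one palindromic factor with each letter, namely its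
    longest palindromic suffix; so a word is rich exactly when the longest
    palindromic suffix of each nonempty prefix occurs there for the first time
    ([rich_rcons]). Since [a :: s] and [rcons s b] are rich and the whole word
    is not, its longest palindromic suffix [p] occurs again, but only as a
    prefix ([lps_prefix]). By reflection the longest palindromic prefix is also
    a suffix, hence it is [p] as well; in particular the word is not a
    palindrome.

    Now let [u] be [a :: s], let [q] be [lps u], and let [v] be [rcons q b].
    As [q] occurs only once in the rich word [u], of which [p] is a proper
    prefix, [q] is not a factor of [p]. So [v], a suffix of the whole word, is
    longer than [p]: it is not a palindrome, whence [lpp v = q = lps u], and it
    has [p] as a suffix, whence [lps v = p = lpp u]. Moreover [q] is not all of
    [u], as no palindromic prefix is longer than [p]; so [v] is a proper factor,
    hence rich. Finally [u = rev v] would force [v = rcons s b] by length, and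
    then the whole word would be a palindrome. *)

Section Palindromes.
Variable A : eqType.
Implicit Types (a b : A) (f p q s t v w : seq A).

(** * Longest palindromic suffixes and prefixes *)

Lemma palindrome_rev p : palindrome p -> rev p = p.
Proof. by move=> /eqP. Qed.

Lemma prefix_of_prefix p q w :
  prefix p w -> prefix q w -> size p <= size q -> prefix p q.
Proof.
rewrite !prefixE => /eqP Ep /eqP Eq le_pq.
by rewrite -Eq take_takel // Ep.
Qed.

Lemma suffix_of_suffix p q w :
  suffix p w -> suffix q w -> size p <= size q -> suffix p q.
Proof.
rewrite -!(prefix_rev _ w) -(size_rev p) -(size_rev q) -prefix_rev.
exact: prefix_of_prefix.
Qed.

Lemma suffix_size_eq p q w :
  suffix p w -> suffix q w -> size p = size q -> p = q.
Proof. by rewrite !suffixE => /eqP Ep /eqP Eq E; rewrite -Ep -Eq E. Qed.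

Lemma infix_size_eq f w : infix f w -> size f = size w -> f = w.
Proof.
case/infixP=> x [y ->]; rewrite !size_cat => Esz.
have /size0nil-> : size x = 0 by lia.
have /size0nil-> : size y = 0 by lia.
by rewrite cats0.
Qed.

Lemma lps_eq w p :
    suffix p w -> palindrome p ->
    (forall f, suffix f w -> palindrome f -> size f <= size p) ->
  lps w = p.
Proof.
move=> sp pp maxp; have [sl pl maxl] := lps_spec w.
by apply: (suffix_size_eq sl sp); apply/eqP; rewrite eqn_leq maxp ?maxl.
Qed.

Lemma lpp_eq w p :
    prefix p w -> palindrome p ->
    (forall f, prefix f w -> palindrome f -> size f <= size p) ->
  lpp w = p.
Proof.
move=> sp pp maxp; have [sl pl maxl] := lpp_spec w.
apply: (can_inj revK).
apply: (@suffix_size_eq _ _ (rev w)); rewrite ?suffix_rev //.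
by apply/eqP; rewrite !size_rev eqn_leq maxp ?maxl.
Qed.

Lemma lps_rev w : lps (rev w) = lpp w.
Proof.
have [pl pal maxl] := lpp_spec w.
apply: lps_eq => // [|f sf pf].
  by rewrite -(palindrome_rev pal) suffix_rev.
by apply: maxl => //; rewrite -suffix_rev palindrome_rev.
Qed.

(** * Richness, one letter at a time *)

Lemma rich_rev w : rich (rev w) = rich w.
Proof.
rewrite /rich /defect size_rev.
suff /perm_size-> : perm_eq (pal_factors (rev w)) (pal_factors w) by [].
apply: uniq_perm; rewrite ?undup_uniq // => f; rewrite !mem_pal_factors.
case: (boolP (palindrome f)) => //= /palindrome_rev pf.
by rewrite -{1}pf infix_rev.
Qed.

(** A palindromic suffix shorter than the longest one is, by reflection, also a
    prefix of the longest one, hence already occurs in [t]. *)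
Lemma mem_pal_factors_rcons t b f :
  (f \in pal_factors (rcons t b))
    = (f == lps (rcons t b)) || (f \in pal_factors t).
Proof.
have [sl pl maxl] := lps_spec (rcons t b).
rewrite !mem_pal_factors; apply/andP/orP => [[pf]|]; last first.
  case=> [/eqP->|/andP[pf it]]; first by split=> //; apply: suffixW.
  by split=> //; rewrite infix_rconsl it orbT.
rewrite infix_rconsl => /orP[sf|it]; last by right; rewrite pf it.
have le_fl := maxl f sf pf.
have [/(suffix_size_eq sf sl)->|ne_fl] :=
  eqVneq (size f) (size (lps (rcons t b))); first by left.
right; rewrite pf /=.
have pre_fl : prefix f (lps (rcons t b)).
  rewrite -suffix_rev !palindrome_rev //.
  exact: suffix_of_suffix sf sl le_fl.
have /suffixP[x Et] := sl; have /prefixP[y El] := pre_fl.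
apply/infixP; move: Et ne_fl; rewrite El size_cat.
case/lastP: y {El} => [|y c]; first by rewrite addn0 eqxx.
rewrite -!rcons_cat => /rcons_inj[-> _] _.
by exists x, y.
Qed.

Lemma size_pal_factors_rcons t b :
  size (pal_factors (rcons t b))
    = ~~ infix (lps (rcons t b)) t + size (pal_factors t).
Proof.
have [_ pl _] := lps_spec (rcons t b).
have inE_l : infix (lps (rcons t b)) t = (lps (rcons t b) \in pal_factors t).
  by rewrite mem_pal_factors pl.
rewrite inE_l; case: (boolP (_ \in _)) => l_in.
  apply/perm_size/uniq_perm; rewrite ?undup_uniq // => f.
  by rewrite mem_pal_factors_rcons; case: eqP => // ->.
apply/(@perm_size _ _ (lps (rcons t b) :: pal_factors t))/uniq_perm.
- exact: undup_uniq.
- by rewrite /= l_in undup_uniq.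
by move=> f; rewrite mem_pal_factors_rcons in_cons.
Qed.

Lemma size_pal_factors w : size (pal_factors w) <= (size w).+1.
Proof.
elim/last_ind: w => [|t b IH] //.
by rewrite size_pal_factors_rcons size_rcons; lia.
Qed.

Lemma rich_rcons t b :
  rich (rcons t b) = rich t && ~~ infix (lps (rcons t b)) t.
Proof.
rewrite /rich /defect size_pal_factors_rcons size_rcons.
by have := size_pal_factors t; case: (infix _ _) => /=; lia.
Qed.

(** * Words that are not rich but whose proper factors are *)

(** The longest palindromic suffix recurs in [a :: s] because the whole word is
    not rich, but not in [s] because [rcons s b] is. *)
Lemma lps_prefix a s b :
    rich (a :: s) -> rich (rcons s b) -> ~~ rich (a :: rcons s b) ->
  prefix (lps (a :: rcons s b)) (a :: s).
Proof.
rewrite -rcons_cons !rich_rcons => -> /andP[_ new_s]; rewrite negbK => il.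
have [sl pl maxl] := lps_spec (rcons (a :: s) b).
move: il; rewrite infix_consl => /orP[//|il].
suff El : lps (rcons s b) = lps (rcons (a :: s) b).
  by rewrite El il in new_s.
have s_w : suffix (rcons s b) (rcons (a :: s) b) by apply: suffix_cons.
apply: lps_eq => // [|f sf]; last exact/maxl/(suffix_trans sf).
apply: suffix_of_suffix sl s_w _.
by have := size_infix il; rewrite size_rcons; lia.
Qed.

Lemma lpp_suffix a s b :
    rich (a :: s) -> rich (rcons s b) -> ~~ rich (a :: rcons s b) ->
  suffix (lpp (a :: rcons s b)) (rcons s b).
Proof.
move=> ru rs nrw.
have [_ pl _] := lpp_spec (a :: rcons s b).
rewrite -prefix_rev palindrome_rev // -lps_rev rev_cons rev_rcons rcons_cons.
apply: lps_prefix; first by rewrite -rev_rcons rich_rev.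
  by rewrite -rev_cons rich_rev.
by rewrite -rcons_cons -rev_rcons -rev_cons rich_rev.
Qed.

Lemma minimal_not_rich w :
    ~~ rich w -> (forall f, infix f w -> f != w -> rich f) ->
  exists u v,
    [/\ infix u w /\ infix v w, u <> rev v, rich u /\ rich v,
        lps u = lpp v & lps v = lpp u].
Proof.
case: w => [|a w]; first by [].
case/lastP: w => [|s b] nrw rich_f.
  (* a one-letter word is rich: its only letter is a new palindrome *)
  have [_ _ maxl] := lps_spec [:: a].
  move: nrw; rewrite -[[:: a]]/(rcons [::] a) rich_rcons infixs0 negb_and negbK.
  case/orP=> // /eqP E.
  by have := maxl [:: a] (suffix_refl _) (eqxx _); rewrite E.
set w := a :: rcons s b in nrw rich_f *.
have u_w : prefix (a :: s) w by rewrite /w -rcons_cons prefix_rcons.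
have s_w : suffix (rcons s b) w by apply: suffix_cons.
have rich_short f : infix f w -> size f <= (size s).+1 -> rich f.
  move=> fw le_f; apply: rich_f => //; apply/eqP => Ef.
  by move: le_f; rewrite Ef /= size_rcons ltnn.
have ru : rich (a :: s) by apply: rich_short => //; apply: prefixW.
have rs : rich (rcons s b).
  by apply: rich_short; [apply: suffixW | rewrite size_rcons].
have p_u := lps_prefix ru rs nrw; have pp_s := lpp_suffix ru rs nrw.
rewrite -/w in p_u pp_s.
have [p_w pal_p maxp] := lps_spec w; have [pp_w pal_pp maxpp] := lpp_spec w.
have Ep : lpp w = lps w.
  apply: suffix_size_eq (suffix_trans pp_s s_w) p_w _.
  apply/eqP; rewrite eqn_leq maxp ?(suffix_trans pp_s) //=.
  exact/maxpp/pal_p/(prefix_trans p_u).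
rewrite {}Ep {pp_s pp_w pal_pp} in maxpp.
set p := lps w in p_u p_w pal_p maxp maxpp.
have npal_w : ~~ palindrome w.
  apply/negP => /(maxp _ (suffix_refl _)); apply/negP; rewrite -ltnNge.
  by apply: leq_ltn_trans (size_prefix p_u) _; rewrite /= size_rcons.
have ne_su : rev (rcons s b) <> a :: s.
  rewrite rev_rcons => -[Eb Es]; case/negP: npal_w.
  by rewrite /palindrome /w rev_cons rev_rcons Es Eb.
have lt_pu : size p < size (a :: s).
  (* [p] is both a prefix and a suffix: if it had length one less than [w], then
     [a :: s] and [rcons s b] would be the same palindrome *)
  rewrite ltn_neqAle size_prefix // andbT; apply/eqP => Esz.
  have Epu : p = a :: s.
    by apply/eqP; move: p_u; rewrite prefixE Esz take_size eq_sym.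
  apply: ne_su; rewrite -Epu -[RHS](palindrome_rev pal_p); congr rev.
  apply: suffix_size_eq s_w p_w _.
  by rewrite Esz size_rcons.
set q := lps (a :: s); have [q_u pal_q _] := lps_spec (a :: s).
rewrite -/q in q_u pal_q.
have q_notin_p : ~~ infix q p.
  (* an occurrence of [q] inside [p] would end before the last letter of the
     rich word [a :: s] *)
  apply/negP => qp; move: ru; rewrite lastI rich_rcons -lastI -/q => /andP[_].
  apply/negP; rewrite negbK; apply: infix_prefix_trans qp _.
  apply: prefix_of_prefix p_u _ _; first by rewrite lastI prefix_rcons.
  by rewrite size_belast.
have v_w : suffix (rcons q b) w by rewrite /w -rcons_cons suffix_rcons eqxx.
have lt_pv : size p < size (rcons q b).
  rewrite ltnNge; apply/negP => le_vp; case/negP: q_notin_p.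
  apply: infix_trans (infix_rcons q b) _.
  exact/suffixW/(suffix_of_suffix v_w p_w le_vp).
have lpp_u : lpp (a :: s) = p.
  by apply: lpp_eq => // f fu; apply/maxpp/(prefix_trans fu).
have lps_v : lps (rcons q b) = p.
  apply: lps_eq => // [|f fv]; last exact/maxp/(suffix_trans fv).
  exact: suffix_of_suffix p_w v_w (ltnW lt_pv).
have lpp_v : lpp (rcons q b) = q.
  apply: lpp_eq => // [|f fv pal_f]; first exact: prefix_rcons.
  have := size_prefix fv; rewrite leq_eqVlt size_rcons ltnS.
  case/orP=> // /eqP Esz; have Ef : f = rcons q b.
    apply/eqP; move: fv.
    by rewrite prefixE Esz -(size_rcons q b) take_size eq_sym.
  by have := maxp f; rewrite Ef v_w -{1}Ef pal_f leqNgt lt_pv => /(_ isT isT).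
exists (a :: s), (rcons q b); split=> //; last by rewrite lps_v.
- by split; [apply: prefixW | apply: suffixW].
- move=> Eu; apply: ne_su; rewrite Eu; congr rev.
  apply: suffix_size_eq s_w v_w _.
  by have := congr1 size Eu; rewrite size_rev !size_rcons.
- split=> //; apply: rich_short; first exact: suffixW.
  (* otherwise [a :: s] would be a palindromic prefix longer than [p] *)
  rewrite size_rcons ltnNge; apply/negP => le_uq.
  have Eq : q = a :: s.
    apply: (suffix_size_eq q_u (suffix_refl _)).
    by apply/eqP; rewrite eqn_leq size_suffix.
  have := maxpp _ u_w; rewrite -{1}Eq => /(_ pal_q).
  by rewrite leqNgt lt_pu.
Qed.

End Palindromes.

Theorem proposition12 (A : finType) (w : seq A) (hw : ~~ rich w) :
  exists u v : seq A,
    [/\ infix u w /\ infix v w,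
        u <> rev v,
        rich u /\ rich v,
        lps u = lpp v
      & lps v = lpp u].
Proof.
have [n] := ubnP (size w); elim: n w hw => // n IH w nrw lt_w.
have [/hasP[f] | min_w] :=
  boolP (has (fun f => (f != w) && ~~ rich f) (factors w)).
  rewrite mem_factors => fw /andP[ne_f nrf].
  have lt_f : size f < n.
    apply: (@leq_trans (size w)) => //; rewrite ltn_neqAle size_infix // andbT.
    by apply/eqP => /(infix_size_eq fw)/eqP; rewrite (negPf ne_f).
  have [u [v [[uf vf] ne ruv Euv Evu]]] := IH f nrf lt_f.
  by exists u, v; split=> //; split; apply: infix_trans fw.
apply: minimal_not_rich => // f fw ne_f; apply: contraNT min_w => nrf.
by apply/hasP; exists f; rewrite ?mem_factors ?ne_f.
Qed.
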